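(* Let $G$ be a finite group, let $(T,[\;],\alpha)$ be a $G$-Hom Lie triple system over a field $k$, let $n\ge 1$, and let $\mu_t=\sum_{i=0}^n\mu_it^i$ be an equivariant formal one-parameter deformation of $T$ of order $n$. Then the $(n+1)$th obstruction cochain $Ob_{n+1}(T)=F_{n+1}\in C^5_{G(\alpha)}(T)$ is a 5-cocycle, i.e. $\delta^5 Ob_{n+1}(T)=0$.
   Context: A (multiplicative) Hom Lie triple system $(T,[\;],\alpha)$ over $k$ is a $k$-vector space $T$ with a $k$-trilinear operation $[abc]$ and a linear map $\alpha:T\to T$ such that for all $a,b,c,d,e\in T$: $[aac]=0$; $[abc]+[bca]+[cab]=0$; $[\alpha(a)\alpha(b)[cde]]=[[abc]\alpha(d)\alpha(e)]+[\alpha(c)[abd]\alpha(e)]+[\alpha(c)\alpha(d)[abe]]$; and $\alpha[abc]=[\alpha(a)\alpha(b)\alpha(c)]$. A $G$-Hom Lie triple system is a multiplicative Hom Lie triple system $T$ with a left action of $G$ by linear maps such that $[ga\,gb\,gc]=g[abc]$ and $\alpha(ga)=g\alpha(a)$ for all $g\in G$, $a,b,c\in T$. Cochains: for $m\ge 0$, $C^{2m+1}_{G(\alpha)}(T)$ is the space of $(2m+1)$-linear maps $f:T^{2m+1}\to T$ with $\alpha f(x_1,\dots,x_{2m+1})=f(\alpha(x_1),\dots,\alpha(x_{2m+1}))$, $f(gx_1,\dots,gx_{2m+1})=gf(x_1,\dots,x_{2m+1})$ for all $g\in G$, and, if $m\ge1$, $f(x_1,\dots,x_{2m-2},x,x,y)=0$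 and $f(x_1,\dots,x_{2m-2},x,y,z)+f(x_1,\dots,x_{2m-2},y,z,x)+f(x_1,\dots,x_{2m-2},z,x,y)=0$. Put $\theta(a,b)v=[vab]$ and $D(a,b)=\theta(b,a)-\theta(a,b)$ (adjoint representation with respect to $\alpha$). For $m\ge1$ the coboundary $\delta^{2m-1}:C^{2m-1}_{G(\alpha)}(T)\to C^{2m+1}_{G(\alpha)}(T)$ is $$\begin{aligned}\delta^{2m-1}f(x_1,\dots,x_{2m+1})={}&\theta(\alpha^{m-1}(x_{2m}),\alpha^{m-1}(x_{2m+1}))f(x_1,\dots,x_{2m-1})\\&-\theta(\alpha^{m-1}(x_{2m-1}),\alpha^{m-1}(x_{2m+1}))f(x_1,\dots,x_{2m-2},x_{2m})\\&+\sum_{k=1}^{m}(-1)^{k+m}D(\alpha^{m-1}(x_{2k-1}),\alpha^{m-1}(x_{2k}))f(x_1,\dots,\widehat{x_{2k-1}},\widehat{x_{2k}},\dots,x_{2m+1})\\&+\sum_{k=1}^{m}\sum_{j=2k+1}^{2m+1}(-1)^{m+k+1}f(\alpha(x_1),\dots,\widehat{x_{2k-1}},\widehat{x_{2k}},\dots,[x_{2k-1}x_{2k}x_j],\dots,\alpha(x_{2m+1})),\end{aligned}$$ where hats denote omission, and in the last sum the entry $x_j$ is replaced by $[x_{2k-1}x_{2k}x_j]$ and $\alpha$ is applied to all other remaining entries. An equivariant formal one-parameter deformation of order $n$ of $T$ is a $k[[t]]$-trilinear operation $\mu_t=\sum_{i=0}^n\mu_it^i$ on $T[[t]]$ with $\mu_i:T^{\otimes3}\to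 T$ linear, $\mu_0(a,b,c)=[abc]$, $\mu_i(ga,gb,gc)=g\mu_i(a,b,c)$ for all $g\in G$, and for all $0\le r\le n$ and $a,b,c,d,e\in T$: $\mu_r(\alpha(a),\alpha(b),\alpha(c))=\alpha\mu_r(a,b,c)$; $\mu_r(a,a,b)=0$; $\mu_r(a,b,c)+\mu_r(b,c,a)+\mu_r(c,a,b)=0$; and $$\sum_{i+j=r}\mu_i(\alpha(a),\alpha(b),\mu_j(c,d,e))=\sum_{i+j=r}\{\mu_i(\mu_j(a,b,c),\alpha(d),\alpha(e))+\mu_i(\alpha(c),\mu_j(a,b,d),\alpha(e))+\mu_i(\alpha(c),\alpha(d),\mu_j(a,b,e))\}.$$ The $(n+1)$th obstruction cochain is $$F_{n+1}(a,b,c,d,e)=\sum_{\substack{i+j=n+1\\ i,j>0}}\Big(\mu_i(\alpha(a),\alpha(b),\mu_j(c,d,e))-\mu_i(\mu_j(a,b,c),\alpha(d),\alpha(e))-\mu_i(\alpha(c),\mu_j(a,b,d),\alpha(e))-\mu_i(\alpha(c),\alpha(d),\mu_j(a,b,e))\Big).$$ *)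

(* Defs.v *)
From mathcomp Require Import all_boot all_algebra fingroup.

Set Implicit Arguments.
Unset Strict Implicit.
Unset Printing Implicit Defensive.

Import GRing.Theory.
Local Open Scope ring_scope.

Definition trilinear (k : fieldType) (T : lmodType k) (f : T -> T -> T -> T)
    : Prop :=
  [/\ forall b c, linear (fun a => f a b c),
      forall a c, linear (fun b => f a b c)
    & forall a b, linear (fun c => f a b c)].

(* Multiplicative Hom Lie triple systems; [br a b c] is $[abc]$. *)
Record is_hom_lts (k : fieldType) (T : lmodType k)
    (br : T -> T -> T -> T) (alpha : {linear T -> T}) : Prop := {
  hlts_trilinear : trilinear br;
  hlts_alt : forall a b, br a a b = 0;
  hlts_jacobi : forall a b c, br a b c + br b c a + br c a b = 0;
  hlts_hom : forall a b c d e,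
    br (alpha a) (alpha b) (br c d e) =
      br (br a b c) (alpha d) (alpha e)
      + br (alpha c) (br a b d) (alpha e)
      + br (alpha c) (alpha d) (br a b e);
  hlts_mult : forall a b c,
    alpha (br a b c) = br (alpha a) (alpha b) (alpha c)
}.

(* The library's actions [{action gT &-> T}] are right actions; the one here is
   a left action. *)
Record is_G_hom_lts (k : fieldType) (T : lmodType k) (gT : finGroupType)
    (br : T -> T -> T -> T) (alpha : {linear T -> T})
    (act : gT -> {linear T -> T}) : Prop := {
  ghlts_hlts : is_hom_lts br alpha;
  ghlts_act1 : forall v, act 1%g v = v;
  ghlts_actM : forall g h v, act (g * h)%g v = act g (act h v);
  ghlts_br : forall g a b c,
    br (act g a) (act g b) (act g c) = act g (br a b c);
  ghlts_alpha : forall g a, alpha (act g a) = act g (alpha a)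
}.

Definition upd (T : Type) (p : nat) (x : {ffun 'I_p -> T}) (j : 'I_p) (v : T)
    : {ffun 'I_p -> T} :=
  [ffun i => if i == j then v else x i].

Definition multilinear (k : fieldType) (T : lmodType k) (p : nat)
    (f : {ffun 'I_p -> T} -> T) : Prop :=
  forall (x : {ffun 'I_p -> T}) (j : 'I_p), linear (fun v => f (upd x j v)).

(* Arguments are numbered from 0, so $x_1, \dots, x_{2m+1}$ are
   [x 0, ..., x (2m)].  For [0 < m], [set_last3 x a b c] is
   $(x_1, \dots, x_{2m-2}, a, b, c)$. *)
Definition set_last3 (T : Type) (m : nat) (x : {ffun 'I_(m.*2.+1) -> T})
    (a b c : T) : {ffun 'I_(m.*2.+1) -> T} :=
  [ffun i : 'I_(m.*2.+1) =>
     if i == m.*2.-2 :> nat then a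
     else if i == m.*2.-1 :> nat then b
     else if i == m.*2 :> nat then c
     else x i].

(* Membership in $C^{2m+1}_{G(\alpha)}(T)$. *)
Record cochain (k : fieldType) (T : lmodType k) (gT : finGroupType)
    (alpha : {linear T -> T}) (act : gT -> {linear T -> T})
    (m : nat) (f : {ffun 'I_(m.*2.+1) -> T} -> T) : Prop := {
  cochain_multilinear : multilinear f;
  cochain_alpha : forall x, alpha (f x) = f [ffun i => alpha (x i)];
  cochain_act : forall g (x : {ffun 'I_(m.*2.+1) -> T}),
    f [ffun i => act g (x i)] = act g (f x);
  cochain_alt : (0 < m)%N -> forall x a b, f (set_last3 x a a b) = 0;
  cochain_jacobi : (0 < m)%N -> forall x a b c,
    f (set_last3 x a b c) + f (set_last3 x b c a) + f (set_last3 x c a b) = 0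
}.

Definition theta (k : fieldType) (T : lmodType k) (br : T -> T -> T -> T)
    (a b v : T) : T := br v a b.

Definition Dop (k : fieldType) (T : lmodType k) (br : T -> T -> T -> T)
    (a b v : T) : T := theta br b a v - theta br a b v.

(* The 0-based position, in $x_1, \dots, x_{2m+1}$, of the [i]-th entry that
   remains once positions [2k] and [2k+1] are omitted: [i] if [i < 2k], and
   [i + 2] otherwise. *)
Definition skip2 (k i : nat) : nat := bump k.*2 (bump k.*2 i).

(* $\delta^{2m-1} : C^{2m-1} \to C^{2m+1}$ with $m = p + 1$, so that
   $2m-1 = 2p+1$ and $2m+1 = 2p+3$.  Both the arguments and the index [k] are
   numbered from 0: $x_j$ is [x (j - 1)] and the [k] below is $k - 1$, whence the
   signs $(-1)^{k+m}$ and $(-1)^{m+k+1}$ become [(-1) ^+ (k + p)] and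
   [(-1) ^+ (k + p).+1]. *)
Definition coboundary (k : fieldType) (T : lmodType k)
    (br : T -> T -> T -> T) (alpha : {linear T -> T}) (p : nat)
    (f : {ffun 'I_(p.*2.+1) -> T} -> T) (x : {ffun 'I_(p.+1.*2.+1) -> T}) : T :=
  let y (j : nat) : T := x (inord j) in
  let ay (j : nat) : T := iter p alpha (y j) in
  theta br (ay p.*2.+1) (ay p.*2.+2) (f [ffun i : 'I_(p.*2.+1) => y i])
  - theta br (ay p.*2) (ay p.*2.+2)
      (f [ffun i : 'I_(p.*2.+1) => if i == p.*2 :> nat then y p.*2.+1 else y i])
  + \sum_(0 <= k < p.+1) (-1) ^+ (k + p) *:
      Dop br (ay k.*2) (ay k.*2.+1)
        (f [ffun i : 'I_(p.*2.+1) => y (skip2 k i)])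
  + \sum_(0 <= k < p.+1) \sum_(k.*2.+2 <= j < p.*2.+3) (-1) ^+ (k + p).+1 *:
      f [ffun i : 'I_(p.*2.+1) =>
           if skip2 k i == j then br (y k.*2) (y k.*2.+1) (y j)
           else alpha (y (skip2 k i))].

(* Formal power series in $T[[t]]$ are represented by their coefficient
   sequences [nat -> T]; this is the coefficient of $t^r$ in
   $\sum_{i=0}^n \mu_i(u, v, w) t^i$, with each $\mu_i$ extended
   $k[[t]]$-trilinearly. *)
Definition series_op_coef (k : fieldType) (T : lmodType k) (n : nat)
    (mu : nat -> T -> T -> T -> T) (u v w : nat -> T) (r : nat) : T :=
  \sum_(i < n.+1) \sum_(a < r.+1) \sum_(b < r.+1)
    \sum_(c < r.+1 | (i + a + b + c == r)%N) mu i (u a) (v b) (w c).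

(* [mut] is the operation $\mu_t$ on $T[[t]]$ and [mu i] is $\mu_i$; only the
   values [mu i] with [i <= n] matter. *)
Record is_equivariant_deformation (k : fieldType) (T : lmodType k)
    (gT : finGroupType) (br : T -> T -> T -> T) (alpha : {linear T -> T})
    (act : gT -> {linear T -> T}) (n : nat)
    (mut : (nat -> T) -> (nat -> T) -> (nat -> T) -> (nat -> T))
    (mu : nat -> T -> T -> T -> T) : Prop := {
  def_series : forall u v w r, mut u v w r = series_op_coef n mu u v w r;
  def_trilinear : forall i, (i <= n)%N -> trilinear (mu i);
  def_mu0 : forall a b c, mu 0%N a b c = br a b c;
  def_act : forall i, (i <= n)%N -> forall g a b c,
    mu i (act g a) (act g b) (act g c) = act g (mu i a b c);
  def_alpha : forall r, (r <= n)%N -> forall a b c,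
    mu r (alpha a) (alpha b) (alpha c) = alpha (mu r a b c);
  def_alt : forall r, (r <= n)%N -> forall a b, mu r a a b = 0;
  def_jacobi : forall r, (r <= n)%N -> forall a b c,
    mu r a b c + mu r b c a + mu r c a b = 0;
  def_hom : forall r, (r <= n)%N -> forall a b c d e,
    \sum_(i < r.+1) mu i (alpha a) (alpha b) (mu (r - i)%N c d e) =
    \sum_(i < r.+1)
      (mu i (mu (r - i)%N a b c) (alpha d) (alpha e)
       + mu i (alpha c) (mu (r - i)%N a b d) (alpha e)
       + mu i (alpha c) (alpha d) (mu (r - i)%N a b e))
}.

(* $F_{n+1}$; the pairs $(i, j)$ with $i + j = n + 1$ and $i, j > 0$ are the
   $(i, n + 1 - i)$ with $1 \le i \le n$. *)
Definition obstruction (k : fieldType) (T : lmodType k)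
    (alpha : {linear T -> T}) (n : nat) (mu : nat -> T -> T -> T -> T)
    (a b c d e : T) : T :=
  \sum_(1 <= i < n.+1)
    (mu i (alpha a) (alpha b) (mu (n.+1 - i)%N c d e)
     - mu i (mu (n.+1 - i)%N a b c) (alpha d) (alpha e)
     - mu i (alpha c) (mu (n.+1 - i)%N a b d) (alpha e)
     - mu i (alpha c) (alpha d) (mu (n.+1 - i)%N a b e)).

Definition Ob (k : fieldType) (T : lmodType k)
    (alpha : {linear T -> T}) (n : nat) (mu : nat -> T -> T -> T -> T)
    (x : {ffun 'I_(2.*2.+1) -> T}) : T :=
  obstruction alpha n mu
    (x (inord 0)) (x (inord 1)) (x (inord 2)) (x (inord 3)) (x (inord 4)).

(* Main.v *)
Require Import Defs.
From mathcomp Require Import all_boot all_algebra fingroup.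
From mathcomp Require Import zify.

(** Write [D^mu_(a,b) c = mu a b c] and extend the bracket to the operation
    [mu_t] on power series.  The failure of the fundamental identity,
      [defect mu mu a b c d e = D_(a,b) (mu c d e) - mu (D_(a,b) c) d e - ...]
    (twisted by [alpha]), measures by how much [D_(a,b)] fails to be a derivation
    of [mu].  As a function of [e] it is also the difference between the
    commutator of [D_(a,b)] and [D_(c,d)] and the operator
    [D_(mu a b c, d) + D_(c, mu a b d)].  Acting on [mu] with that commutator in
    these two ways gives a Bianchi identity, valid for every multiplicative
    trilinear operation: the coboundary of [defect mu mu], formed with [mu] in
    place of the bracket, vanishes.

    Now take the coefficient of [t ^ (n+1)].  The coefficients of the defect of
    [mu_t] of degree at most [n] vanish because [mu_t] is a deformation, so the
    only terms left are those pairing [mu_0], the bracket, with the coefficient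
    of degree [n+1]; extending [mu_t] by [mu_(n+1) = 0], that coefficient is the
    obstruction.  What is left is exactly [coboundary br (Ob mu) = 0].

    The argument is carried out on coefficients.  [bianchi] is the polarized
    identity for three operations [la], [mu], [nu].  Terms in which the three
    operations are nested in a chain cancel for fixed [la], [mu], [nu]; those in
    which [la] receives both [mu] and [nu] cancel only against the terms with
    [mu] and [nu] exchanged, and they are collected in [fork].  Summing over all
    [i + j + l = n+1] removes the forks ([first_defect_closed]).  The coboundary
    of the complex is split by [coboundary5E] into the part where the bracket is
    applied last ([cob_outer]) and the part where it is applied first
    ([cob_inner]).

    That the obstruction is a cochain is checked on each [defect (mu i) (mu j)]
    separately ([cochain_defect]). *)

Set Implicit Arguments.
Unset Strict Implicit.
Unset Printing Implicit Defensive.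
Import GRing.Theory.
Local Open Scope ring_scope.

(** * Cancellation in abelian groups *)

Lemma addr_pull (V : zmodType) (a b t u : V) :
  a = b + t -> a + u = b + u + t.
Proof. by move=> ->; rewrite addrAC. Qed.

Lemma addr_match (V : zmodType) (a b c t : V) : c = b + t -> a = b -> a + t = c.
Proof. by move=> -> ->. Qed.

Lemma addr_cancelN (V : zmodType) (a b c t : V) :
  a = b + t -> b = c -> a - t = c.
Proof. by move=> -> ->; rewrite addrK. Qed.

Lemma addr_cancel (V : zmodType) (a b c t : V) :
  a = b - t -> b = c -> a + t = c.
Proof. by move=> -> ->; rewrite subrK. Qed.

(* Solves [?a] in [lhs = ?a + t], where [t] is one of the terms of [lhs]. *)
Ltac pull := first [reflexivity | apply: addr_pull; pull].
Ltac zmod_step :=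
  first [ apply: addr_cancelN; [pull|] | apply: addr_cancel; [pull|]
        | apply: addr_match; [pull|] ].
(** Proves an identity between signed sums: the last term of the left-hand side
    is removed together with its opposite on the left or its copy on the right,
    until nothing is left.  The leading zeros ensure that every term, the first
    one included, is the right operand of a sum. *)
Ltac zmod :=
  rewrite -[LHS]add0r -[RHS]add0r ?(opprD, opprK, addrA, oppr0, addr0);
  repeat zmod_step; reflexivity.

(** * Trilinear operations *)

Lemma trilinearP (k : fieldType) (T : lmodType k) (f : T -> T -> T -> T)
    (hf : trilinear f) :
  (forall a u v b c, f (a *: u + v) b c = a *: f u b c + f v b c)
  * (forall a u v b c, f b (a *: u + v) c = a *: f b u c + f b v c)
  * (forall a u v b c, f b c (a *: u + v) = a *: f b c u + f b c v).
Proof.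
by case: hf => h1 h2 h3; split; first split; move=> a u v b c;
  rewrite ?h1 ?h2 ?h3.
Qed.

Lemma trilinearD (k : fieldType) (T : lmodType k) (f : T -> T -> T -> T)
    (hf : trilinear f) :
  (forall u v b c, f (u + v) b c = f u b c + f v b c)
  * (forall u v b c, f b (u + v) c = f b u c + f b v c)
  * (forall u v b c, f b c (u + v) = f b c u + f b c v).
Proof.
by split; first split; move=> u v b c;
  rewrite -{1}[u]scale1r (trilinearP hf) scale1r.
Qed.

Lemma trilinearB (k : fieldType) (T : lmodType k) (f : T -> T -> T -> T)
    (hf : trilinear f) :
  (forall u v b c, f (u - v) b c = f u b c - f v b c)
  * (forall u v b c, f b (u - v) c = f b u c - f b v c)
  * (forall u v b c, f b c (u - v) = f b c u - f b c v).
Proof.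
by split; first split; move=> u v b c;
  rewrite addrC -scaleN1r (trilinearP hf) scaleN1r addrC.
Qed.

Lemma trilinear0 (k : fieldType) (T : lmodType k) (f : T -> T -> T -> T)
    (hf : trilinear f) :
  (forall b c, f 0 b c = 0) * (forall b c, f b 0 c = 0)
  * (forall b c, f b c 0 = 0).
Proof.
by split; first split; move=> b c;
  rewrite -{1}(subrr 0) (trilinearB hf) subrr.
Qed.

Lemma trilinear_sum (k : fieldType) (T : lmodType k) (f : T -> T -> T -> T)
    (hf : trilinear f) m (G : 'I_m -> T) :
  (forall b c, f (\sum_i G i) b c = \sum_i f (G i) b c)
  * (forall b c, f b (\sum_i G i) c = \sum_i f b (G i) c)
  * (forall b c, f b c (\sum_i G i) = \sum_i f b c (G i)).
Proof.
split; first split; move=> b c.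
- by apply: (big_morph (fun u => f u b c)) => [u v|];
    rewrite ?(trilinearD hf) ?(trilinear0 hf).
- by apply: (big_morph (fun u => f b u c)) => [u v|];
    rewrite ?(trilinearD hf) ?(trilinear0 hf).
- by apply: (big_morph (fun u => f b c u)) => [u v|];
    rewrite ?(trilinearD hf) ?(trilinear0 hf).
Qed.

Lemma alternating_skew (k : fieldType) (T : lmodType k) (f : T -> T -> T -> T)
    (hf : trilinear f) (alt : forall a b, f a a b = 0) a b c :
  f a b c = - f b a c.
Proof.
have /eqP := alt (a + b) c.
by rewrite !(trilinearD hf) !alt add0r addr0 addr_eq0 => /eqP.
Qed.

(** * The polarized Bianchi identity *)

Definition defect (k : fieldType) (T : lmodType k) (alpha : T -> T)
    (mu nu : T -> T -> T -> T) (a b c d e : T) : T :=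
  mu (alpha a) (alpha b) (nu c d e)
  - mu (nu a b c) (alpha d) (alpha e)
  - mu (alpha c) (nu a b d) (alpha e)
  - mu (alpha c) (alpha d) (nu a b e).

(** The terms of the coboundary of a 5-cochain [F] in which the ternary operation
    is applied to a value of [F].  The skew-symmetry of the operation has been
    used to write the difference of the two [theta] terms as a sum. *)
Definition cob_outer (k : fieldType) (T : lmodType k) (alpha : T -> T)
    (mu : T -> T -> T -> T) (F : T -> T -> T -> T -> T -> T)
    (x1 x2 x3 x4 x5 x6 x7 : T) : T :=
  let a2 x := alpha (alpha x) in
  mu (F x1 x2 x3 x4 x5) (a2 x6) (a2 x7)
  + mu (a2 x5) (F x1 x2 x3 x4 x6) (a2 x7)
  + mu (a2 x1) (a2 x2) (F x3 x4 x5 x6 x7)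
  - mu (a2 x3) (a2 x4) (F x1 x2 x5 x6 x7)
  + mu (a2 x5) (a2 x6) (F x1 x2 x3 x4 x7).

(** The terms of the coboundary of a 5-cochain [F] in which [F] is applied to a
    value of the ternary operation. *)
Definition cob_inner (k : fieldType) (T : lmodType k) (alpha : T -> T)
    (F : T -> T -> T -> T -> T -> T) (mu : T -> T -> T -> T)
    (x1 x2 x3 x4 x5 x6 x7 : T) : T :=
  let a := alpha in
  - F (mu x1 x2 x3) (a x4) (a x5) (a x6) (a x7)
  - F (a x3) (mu x1 x2 x4) (a x5) (a x6) (a x7)
  - F (a x3) (a x4) (mu x1 x2 x5) (a x6) (a x7)
  - F (a x3) (a x4) (a x5) (mu x1 x2 x6) (a x7)
  - F (a x3) (a x4) (a x5) (a x6) (mu x1 x2 x7)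
  + F (a x1) (a x2) (mu x3 x4 x5) (a x6) (a x7)
  + F (a x1) (a x2) (a x5) (mu x3 x4 x6) (a x7)
  + F (a x1) (a x2) (a x5) (a x6) (mu x3 x4 x7)
  - F (a x1) (a x2) (a x3) (a x4) (mu x5 x6 x7).

(** Half of the terms of the expanded coboundary of a defect in which a value of
    [mu] and a value of [nu] are both arguments of [la]: in each of the eight
    pairs that differ by exchanging [mu] and [nu], the one with sign [+]. *)
Definition fork (k : fieldType) (T : lmodType k) (alpha : T -> T)
    (la mu nu : T -> T -> T -> T) (x1 x2 x3 x4 x5 x6 x7 : T) : T :=
  let a2 x := alpha (alpha x) in
  let m x y z := alpha (mu x y z) in
  let n x y z := alpha (nu x y z) in
  la (m x1 x2 x3) (a2 x4) (n x5 x6 x7) + la (a2 x3) (m x1 x2 x4) (n x5 x6 x7)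
  + la (m x3 x4 x5) (n x1 x2 x6) (a2 x7) + la (m x3 x4 x5) (a2 x6) (n x1 x2 x7)
  + la (n x1 x2 x5) (m x3 x4 x6) (a2 x7) + la (a2 x5) (m x3 x4 x6) (n x1 x2 x7)
  + la (n x1 x2 x5) (a2 x6) (m x3 x4 x7) + la (a2 x5) (n x1 x2 x6) (m x3 x4 x7).

(** For [la = mu = nu] the right-hand side is zero, and the left-hand side is the
    coboundary of [defect mu mu]: both sides of the commutator computation
      [(D_(1,2) D_(3,4) - D_(3,4) D_(1,2)) mu
       = D_(1,2) (D_(3,4) mu) - D_(3,4) (D_(1,2) mu)],
    where an operator acts on [mu] by its failure to be a derivation, are expressed
    by defects; on the left this uses the commutator form of [defect].
    For distinct operations the chains [la (mu (nu ...))] occur on the left in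
    opposite pairs, and the forks remain. *)
Lemma bianchi (k : fieldType) (T : lmodType k) (alpha : T -> T)
    (la mu nu : T -> T -> T -> T) x1 x2 x3 x4 x5 x6 x7 :
  trilinear la -> trilinear mu -> trilinear nu ->
  (forall a b c, mu (alpha a) (alpha b) (alpha c) = alpha (mu a b c)) ->
  (forall a b c, nu (alpha a) (alpha b) (alpha c) = alpha (nu a b c)) ->
  cob_outer alpha la (defect alpha mu nu) x1 x2 x3 x4 x5 x6 x7
  + cob_inner alpha (defect alpha la mu) nu x1 x2 x3 x4 x5 x6 x7
  = fork alpha la mu nu x1 x2 x3 x4 x5 x6 x7
    - fork alpha la nu mu x1 x2 x3 x4 x5 x6 x7.
Proof.
move=> hl hm hn am an; rewrite /cob_outer /cob_inner /fork /defect /=.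
rewrite !(trilinearB hl) ?am ?an.
zmod.
Qed.

(** * The coboundary of a 5-cochain *)

Lemma coboundary5E (k : fieldType) (T : lmodType k)
    (br : T -> T -> T -> T) (alpha : {linear T -> T})
    (F : T -> T -> T -> T -> T -> T)
    (x : {ffun 'I_(3.*2.+1) -> T}) :
  (forall a b c, br a b c = - br b a c) ->
  (forall a b c, br a b c + br b c a + br c a b = 0) ->
  let y i := x (inord i) in
  coboundary br alpha (p := 2)
    (fun u => F (u (inord 0)) (u (inord 1)) (u (inord 2)) (u (inord 3))
                (u (inord 4))) x
  = cob_outer alpha br F
      (y 0%N) (y 1%N) (y 2%N) (y 3%N) (y 4%N) (y 5%N) (y 6%N)
    + cob_inner alpha F br
      (y 0%N) (y 1%N) (y 2%N) (y 3%N) (y 4%N) (y 5%N) (y 6%N).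
Proof.
move=> sk jac y.
(* The Jacobi identity turns [D(a,b)] into left multiplication. *)
have D a b v : Dop br a b v = br a b v.
  rewrite /Dop /theta (sk v a) opprK (sk a b).
  by apply/eqP; rewrite -addr_eq0 addrAC jac.
rewrite /coboundary /index_iota /= !big_cons !big_nil.
rewrite !ffunE !inordK //= -!/(y _); clearbody y.
rewrite !D /skip2 /bump /=.
rewrite -!(signr_odd _ (_ + _)) -!(signr_odd _ (_.+1)) /=.
rewrite ?expr0 ?expr1 !(scale1r, scaleN1r).
rewrite !(doubleS, double0, add0n, add1n).
rewrite /theta /cob_outer /cob_inner /=.
rewrite [br (alpha (alpha (y 4))) (F _ _ _ _ _) _]sk.
zmod.
Qed.

Lemma cob_outer_sum (k : fieldType) (T : lmodType k) (alpha : T -> T)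
    (mu : T -> T -> T -> T) (hm : trilinear mu)
    (F : T -> T -> T -> T -> T -> T) m
    (G : 'I_m -> T -> T -> T -> T -> T -> T) x1 x2 x3 x4 x5 x6 x7 :
  (forall a b c d e, F a b c d e = \sum_i G i a b c d e) ->
  cob_outer alpha mu F x1 x2 x3 x4 x5 x6 x7
  = \sum_i cob_outer alpha mu (G i) x1 x2 x3 x4 x5 x6 x7.
Proof.
move=> FE; rewrite /cob_outer !FE !(trilinear_sum hm).
by rewrite !big_split /= sumrN.
Qed.

Lemma cob_inner_sum (k : fieldType) (T : lmodType k) (alpha : T -> T)
    (mu : T -> T -> T -> T) (F : T -> T -> T -> T -> T -> T) m
    (G : 'I_m -> T -> T -> T -> T -> T -> T) x1 x2 x3 x4 x5 x6 x7 :
  (forall a b c d e, F a b c d e = \sum_i G i a b c d e) ->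
  cob_inner alpha F mu x1 x2 x3 x4 x5 x6 x7
  = \sum_i cob_inner alpha (G i) mu x1 x2 x3 x4 x5 x6 x7.
Proof. by move=> FE; rewrite /cob_inner !FE !big_split /= !sumrN. Qed.

(** * Sums over triples of given total degree *)

(** The sum over [i + j + l = N] is written over a cube so that its symmetry in
    [i], [j], [l] is an exchange of summations. *)
Definition triples (V : zmodType) N (g : nat -> nat -> nat -> V) : V :=
  \sum_(i < N.+1) \sum_(j < N.+1) \sum_(l < N.+1)
    if (i + j + l == N)%N then g i j l else 0.

Lemma triples_slice (V : zmodType) N (g : nat -> nat -> nat -> V) :
  triples N g = \sum_(i < N.+1) \sum_(j < (N - i).+1) g i j (N - i - j)%N.
Proof.
apply: eq_bigr => i _.
have iN : (i <= N)%N by rewrite -ltnS.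
rewrite (big_ord_widen N.+1 (fun j => g i j (N - i - j)%N)) ?ltnS ?leq_subr //.
rewrite [RHS]big_mkcond; apply: eq_bigr => j _; rewrite -big_mkcond ltnS.
case: leqP => [jN|Nj]; last by rewrite big_pred0 // => l; lia.
rewrite (big_pred1 (inord (N - i - j))) ?inordK //; first lia.
by move=> l; rewrite /= -val_eqE /= inordK; lia.
Qed.

Lemma triples_rot (V : zmodType) N (g : nat -> nat -> nat -> V) :
  triples N g = triples N (fun l i j => g i j l).
Proof.
rewrite /triples; under eq_bigr do rewrite exchange_big.
rewrite exchange_big; apply: eq_bigr => l _.
apply: eq_bigr => i _; apply: eq_bigr => j _.
by rewrite -[in RHS]addnA [in RHS]addnC.
Qed.

Lemma triples_swap (V : zmodType) N (g : nat -> nat -> nat -> V) :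
  triples N g = triples N (fun i l j => g i j l).
Proof.
rewrite /triples; apply: eq_bigr => i _; rewrite exchange_big.
by do 2!apply: eq_bigr => ? _; rewrite addnAC.
Qed.

Lemma eq_triples (V : zmodType) N (g h : nat -> nat -> nat -> V) :
  (forall i j l, g i j l = h i j l) ->
  triples N g = triples N h.
Proof. by move=> gh; do 3!apply: eq_bigr => ? _; rewrite gh. Qed.

Lemma triplesD (V : zmodType) N (g h : nat -> nat -> nat -> V) :
  triples N (fun i j l => g i j l + h i j l) = triples N g + triples N h.
Proof.
rewrite -!big_split; apply: eq_bigr => i _; rewrite -!big_split.
apply: eq_bigr => j _; rewrite -!big_split; apply: eq_bigr => l _ /=.
by case: ifP; rewrite // addr0.
Qed.

Lemma triplesN (V : zmodType) N (g : nat -> nat -> nat -> V) :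
  triples N (fun i j l => - g i j l) = - triples N g.
Proof.
rewrite -!sumrN; apply: eq_bigr => i _; rewrite -!sumrN.
apply: eq_bigr => j _; rewrite -!sumrN; apply: eq_bigr => l _ /=.
by case: ifP; rewrite // oppr0.
Qed.

(** * The lowest coefficient of the defect is closed *)

(** The coefficient of [t ^ r] in the defect of [\sum_i mu i * t ^ i] on constant
    power series. *)
Definition defect_coef (k : fieldType) (T : lmodType k) (alpha : T -> T)
    (mu : nat -> T -> T -> T -> T) r (a b c d e : T) : T :=
  \sum_(i < r.+1) defect alpha (mu i) (mu (r - i)%N) a b c d e.

(** The sum of [bianchi] over [i + j + l = N].  Grouping the outer terms by the
    operation applied last, and the inner ones by the operation applied first,
    makes a coefficient of degree [N - i] of the defect appear next to [mu i]; only
    [i = 0] contributes.  The forks cancel by exchanging [j] and [l]. *)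
Lemma first_defect_closed (k : fieldType) (T : lmodType k) (alpha : T -> T)
    (mu : nat -> T -> T -> T -> T) N x1 x2 x3 x4 x5 x6 x7 :
  (forall i, trilinear (mu i)) ->
  (forall i a b c,
     mu i (alpha a) (alpha b) (alpha c) = alpha (mu i a b c)) ->
  (forall r, (r < N)%N -> forall a b c d e,
     defect_coef alpha mu r a b c d e = 0) ->
  cob_outer alpha (mu 0) (defect_coef alpha mu N) x1 x2 x3 x4 x5 x6 x7
  + cob_inner alpha (defect_coef alpha mu N) (mu 0) x1 x2 x3 x4 x5 x6 x7 = 0.
Proof.
move=> lin mult low.
pose out i j l :=
  cob_outer alpha (mu i) (defect alpha (mu j) (mu l)) x1 x2 x3 x4 x5 x6 x7.
pose inn i j l :=
  cob_inner alpha (defect alpha (mu i) (mu j)) (mu l) x1 x2 x3 x4 x5 x6 x7.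
have low0 (i : 'I_N.+1) : i != ord0 -> forall a b c d e,
    defect_coef alpha mu (N - i) a b c d e = 0.
  by rewrite -val_eqE /= => i0; apply: low; have := ltn_ord i; lia.
have outE : triples N out
    = cob_outer alpha (mu 0) (defect_coef alpha mu N) x1 x2 x3 x4 x5 x6 x7.
  rewrite triples_slice.
  under eq_bigr => i _ do rewrite -(cob_outer_sum _ (lin i)
    (F := defect_coef alpha mu (N - i))) //.
  rewrite (bigD1 ord0) //= subn0 [X in _ + X]big1 ?addr0 // => i /low0 F0.
  (* The outer part of the zero cochain, as an empty sum. *)
  by rewrite (cob_outer_sum _ (lin i) (G := fun (_ : 'I_0) _ _ _ _ _ => 0))
    ?big_ord0.
have innE : triples N inn
    = cob_inner alpha (defect_coef alpha mu N) (mu 0) x1 x2 x3 x4 x5 x6 x7.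
  rewrite triples_rot triples_slice.
  under eq_bigr => l _ do rewrite -(cob_inner_sum _ _
    (F := defect_coef alpha mu (N - l))) //.
  rewrite (bigD1 ord0) //= subn0 [X in _ + X]big1 ?addr0 // => l /low0 F0.
  by rewrite /cob_inner !F0 !oppr0 !addr0.
pose frk i j l :=
  fork alpha (mu i) (mu j) (mu l) x1 x2 x3 x4 x5 x6 x7.
have frkE i j l : out i j l + inn i j l = frk i j l - frk i l j.
  exact: bianchi.
rewrite -outE -innE -triplesD (eq_triples _ frkE).
by rewrite triplesD triplesN [X in _ - X]triples_swap subrr.
Qed.

(** * The obstruction cochain *)

Lemma cochain_sum (k : fieldType) (T : lmodType k) (gT : finGroupType)
    (alpha : {linear T -> T}) (act : gT -> {linear T -> T}) p m n
    (f : nat -> {ffun 'I_(p.*2.+1) -> T} -> T) :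
  (forall i, (m <= i < n)%N -> cochain alpha act (f i)) ->
  cochain alpha act (fun x => \sum_(m <= i < n) f i x).
Proof.
move=> cf; split.
- move=> x j a u v; rewrite scaler_sumr -big_split.
  by apply: eq_big_nat => i /cf cfi; apply: (cochain_multilinear cfi).
- move=> x; rewrite linear_sum; apply: eq_big_nat => i /cf cfi.
  exact: cochain_alpha cfi x.
- move=> g x; rewrite linear_sum; apply: eq_big_nat => i /cf cfi.
  exact: cochain_act cfi g x.
- move=> p0 x a b; rewrite big_nat big1 // => i /cf cfi.
  exact: cochain_alt cfi p0 x a b.
- move=> p0 x a b c; rewrite -!big_split big_nat big1 // => i /cf cfi.
  exact: cochain_jacobi cfi p0 x a b c.
Qed.

(** The conditions on a coefficient [mu i] of a deformation other than the
    fundamental identity. *)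
Definition lts_operation (k : fieldType) (T : lmodType k) (gT : finGroupType)
    (alpha : {linear T -> T}) (act : gT -> {linear T -> T})
    (f : T -> T -> T -> T) : Prop :=
  [/\ trilinear f,
      forall g a b c, f (act g a) (act g b) (act g c) = act g (f a b c),
      forall a b c, f (alpha a) (alpha b) (alpha c) = alpha (f a b c),
      forall a b, f a a b = 0
    & forall a b c, f a b c + f b c a + f c a b = 0].

(** [alpha]-compatibility, equivariance and multilinearity are inherited termwise.
    In the last three arguments [c], [d], [e], the first term of the defect inherits
    alternation and the cyclic identity from [nu]; the other three terms sum up to
    the derivation action of [nu a b _] on [mu], which preserves both symmetries
    of [mu]. *)
Lemma cochain_defect (k : fieldType) (T : lmodType k) (gT : finGroupType)
    (alpha : {linear T -> T}) (act : gT -> {linear T -> T})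
    (mu nu : T -> T -> T -> T) :
  (forall g a, alpha (act g a) = act g (alpha a)) ->
  lts_operation alpha act mu -> lts_operation alpha act nu ->
  cochain alpha act (m := 2) (fun x => defect alpha mu nu
    (x (inord 0)) (x (inord 1)) (x (inord 2)) (x (inord 3)) (x (inord 4))).
Proof.
move=> comm [tm gm am altm jm] [tn gn an altn jn].
have skm := alternating_skew tm altm.
split.
- move=> x [[|[|[|[|[|//]]]]] lt_j] a u v; rewrite /defect /upd !ffunE;
    rewrite -!val_eqE /= !inordK //= ?linearP !(trilinearP tn);
    rewrite !(trilinearP tm) ?(scalerDr, scalerN); zmod.
- by move=> x; rewrite /defect !ffunE !linearB /= -?am -?an -?am.
- by move=> g x; rewrite /defect !ffunE !linearB /= !comm -?gm -?gn -?gm.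
- move=> _ x a b; rewrite /defect !ffunE !inordK //= altn altm.
  by rewrite (trilinear0 tm) (skm (alpha a)) sub0r subr0 opprK addNr.
- move=> _ x a b c; rewrite /defect !ffunE !inordK //=.
  set A := alpha (x (inord 0)); set B := alpha (x (inord 1)).
  set n := nu (x (inord 0)) (x (inord 1)).
  pose J u v w := mu u v w + mu v w u + mu w u v.
  transitivity (mu A B (nu a b c + nu b c a + nu c a b)
    - J (n a) (alpha b) (alpha c) - J (n b) (alpha c) (alpha a)
    - J (n c) (alpha a) (alpha b)).
    by rewrite !(trilinearD tm) /J; zmod.
  by rewrite /J !jm jn (trilinear0 tm) !subr0.
Qed.

(** A deformation of order [n], extended to a power series by zero. *)
Definition truncate (k : fieldType) (T : lmodType k) n
    (mu : nat -> T -> T -> T -> T) i : T -> T -> T -> T :=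
  if (i <= n)%N then mu i else fun _ _ _ => 0.

Lemma truncateE (k : fieldType) (T : lmodType k) n
    (mu : nat -> T -> T -> T -> T) i : (i <= n)%N -> truncate n mu i = mu i.
Proof. by rewrite /truncate => ->. Qed.

(** With [mu_(n+1) = 0], the two extreme terms of the coefficient of degree [n+1]
    vanish. *)
Lemma obstructionE (k : fieldType) (T : lmodType k) (alpha : {linear T -> T}) n
    (mu : nat -> T -> T -> T -> T) (tri0 : trilinear (mu 0%N)) a b c d e :
  obstruction alpha n mu a b c d e
  = defect_coef alpha (truncate n mu) n.+1 a b c d e.
Proof.
rewrite /defect_coef big_ord_recl big_ord_recr /= subn0 /bump /= add1n subnn.
rewrite /defect /truncate ltnn /= !(trilinear0 tri0) !subr0 add0r addr0.
rewrite /obstruction big_add1 big_mkord; apply: eq_bigr => i _.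
by rewrite add1n subSS ltn_ord leq_subr.
Qed.

Lemma deformation_defect0 (k : fieldType) (T : lmodType k)
    (gT : finGroupType) (br : T -> T -> T -> T) (alpha : {linear T -> T})
    (act : gT -> {linear T -> T}) n mut mu
    (hmu : is_equivariant_deformation br alpha act n mut mu) r a b c d e :
  (r <= n)%N -> defect_coef alpha (truncate n mu) r a b c d e = 0.
Proof.
move=> rn; have /eqP := def_hom hmu rn a b c d e.
rewrite -subr_eq0 -sumrB => /eqP <-.
apply: eq_bigr => i _; have ir : (i <= r)%N by rewrite -ltnS.
rewrite !truncateE ?(leq_trans ir) ?(leq_trans (leq_subr _ _)) // /defect.
zmod.
Qed.

Theorem theorem5p1 (k : fieldType) (gT : finGroupType) (T : lmodType k)
    (br : T -> T -> T -> T) (alpha : {linear T -> T})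
    (act : gT -> {linear T -> T})
    (hT : is_G_hom_lts br alpha act)
    (n : nat) (hn : (1 <= n)%N)
    (mut : (nat -> T) -> (nat -> T) -> (nat -> T) -> (nat -> T))
    (mu : nat -> T -> T -> T -> T)
    (hmu : is_equivariant_deformation br alpha act n mut mu) :
  cochain alpha act (m := 2) (Ob alpha n mu) /\
  forall x : {ffun 'I_(3.*2.+1) -> T},
    coboundary br alpha (p := 2) (Ob alpha n mu) x = 0.
Proof.
have hL := ghlts_hlts hT.
split.
  have op i : (i <= n)%N -> lts_operation alpha act (mu i).
    move=> le_in; split.
    - exact: def_trilinear hmu _ le_in.
    - exact: def_act hmu _ le_in.
    - exact: def_alpha hmu _ le_in.
    - exact: def_alt hmu _ le_in.
    - exact: def_jacobi hmu _ le_in.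
  apply: (cochain_sum (f := fun i x => defect alpha (mu i) (mu (n.+1 - i)%N)
    (x (inord 0)) (x (inord 1)) (x (inord 2)) (x (inord 3)) (x (inord 4)))).
  move=> i /andP[i_gt0 le_in]; apply: cochain_defect.
  - exact: ghlts_alpha hT.
  - exact: op.
  - by apply: op; lia.
move=> x.
rewrite /Ob (coboundary5E _ (obstruction alpha n mu)); first last.
- exact: hlts_jacobi hL.
- exact: alternating_skew (hlts_trilinear hL) (hlts_alt hL).
have tri i : trilinear (truncate n mu i).
  rewrite /truncate; case: leqP => [le_in|_].
    exact: def_trilinear hmu _ le_in.
  by split=> ? ? a u v /=; rewrite scaler0 addr0.
have mult i a b c : truncate n mu i (alpha a) (alpha b) (alpha c)
    = alpha (truncate n mu i a b c).
  rewrite /truncate; case: leqP => [le_in|_]; last by rewrite linear0.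
  exact: def_alpha hmu _ le_in a b c.
rewrite /cob_outer /cob_inner.
rewrite -!(def_mu0 hmu) !(obstructionE _ _ (def_trilinear hmu (leq0n n))).
apply: (first_defect_closed _ _ _ _ _ _ _ tri mult) => r lt_rn a b c d e.
by apply: (deformation_defect0 hmu); rewrite -ltnS.
Qed.
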